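(* Let $\mathcal{V},\mathcal{W}$ be real, separable, infinite-dimensional Hilbert spaces, fix $c>0$ and $p\in[1,\infty]$, and let $\mathcal{X}=\{v\in\mathcal{V}:\|v\|\le 1\}$, $\mathcal{Y}=\{w\in\mathcal{W}:\|w\|\le c\}$ and $\mathcal{F}_p=\{f\in S_p(\mathcal{V},\mathcal{W}):\|f\|_p\le c\}$. Then for every $T\in\mathbb{N}$, \[\inf_{\mathcal{A}}\mathtt{R}_{\mathcal{A}}(T,\mathcal{F}_p)\;\le\;2\,\mathrm{Rad}_T(\mathcal{F}_p)\;\le\;6c^2\,T^{\max\{\frac12,\,1-\frac1p\}},\] where the infimum ranges over all (possibly randomized) online learning algorithms.
   Context: For a compact linear operator $f:\mathcal{V}\to\mathcal{W}$ with singular values $(s_n(f))_{n\ge1}$, the $p$-Schatten norm is $\|f\|_p=(\sum_n s_n(f)^p)^{1/p}$ for $p\in[1,\infty)$ and $\|f\|_\infty=\sup_n s_n(f)$ (the operator norm); $S_p(\mathcal{V},\mathcal{W})$ is the set of compact linear operators $f$ with $\|f\|_p<\infty$. Online protocol: for $t=1,\dots,T$, an adversary picks $(x_t,y_t)\in\mathcal{X}\times\mathcal{Y}$ and reveals $x_t$; the learner $\mathcal{A}$, using $(x_1,y_1),\dots,(x_{t-1},y_{t-1})$ and $x_t$ (and possibly internal randomness), predicts $\mathcal{A}(x_t)=\hat y_t\in\mathcal{Y}$; then $y_t$ is revealed and the loss is $\|\hat y_t-y_t\|_{\mathcal{W}}^2$. The regret of $\mathcal{A}$ on a class $\mathcal{F}$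 of linear operators is \[\mathtt{R}_{\mathcal{A}}(T,\mathcal{F})=\sup_{(x_1,y_1),\dots,(x_T,y_T)\in\mathcal{X}\times\mathcal{Y}}\mathbb{E}\Big[\sum_{t=1}^T\|\mathcal{A}(x_t)-y_t\|^2-\inf_{f\in\mathcal{F}}\sum_{t=1}^T\|f(x_t)-y_t\|^2\Big],\] the expectation being over the algorithm's randomness. Sequential Rademacher complexity: with $\sigma=(\sigma_1,\dots,\sigma_T)$ i.i.d. uniform on $\{-1,1\}$ and $\sigma_{<t}=(\sigma_1,\dots,\sigma_{t-1})$, \[\mathrm{Rad}_T(\mathcal{F})=\sup_{x,y}\mathbb{E}_\sigma\Big[\sup_{f\in\mathcal{F}}\sum_{t=1}^T\sigma_t\|f(x_t(\sigma_{<t}))-y_t(\sigma_{<t})\|^2\Big],\] where the supremum is over all sequences of maps $(x_t,y_t):\{-1,1\}^{t-1}\to\mathcal{X}\times\mathcal{Y}$, $t=1,\dots,T$. *)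

(* Defs.v *)
From HB Require Import structures.
From mathcomp Require Import all_boot all_order all_algebra.
From mathcomp Require Import all_classical all_reals all_analysis.
Set Implicit Arguments. Unset Strict Implicit. Unset Printing Implicit Defensive.
Import Order.TTheory GRing.Theory Num.Theory.
Import numFieldNormedType.Exports.
Local Open Scope classical_set_scope.
Local Open Scope ring_scope.

Section Defs.
Context {R : realType}.

Definition inner_product_for (V : normedModType R) (ip : V -> V -> R) : Prop :=
  (forall u v, ip u v = ip v u) /\
  (forall (a : R) (u v w : V), ip (a *: u + v) w = a * ip u w + ip v w) /\
  (forall v, `|v| ^+ 2 = ip v v).

Definition separable_inf_dim_hilbert (V : completeNormedModType R)
    (ip : V -> V -> R) : Prop :=
  inner_product_for ip /\
  (exists D : set V, countable D /\ closure D = setT) /\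
  ~ (exists (n : nat) (e : 'I_n -> V),
       forall v : V, exists a : 'I_n -> R, v = \sum_(i < n) a i *: e i).

Definition orthonormal (V : normedModType R) (ip : V -> V -> R) (e : nat -> V) :=
  forall i j : nat, ip (e i) (e j) = (i == j)%:R.

(** s is the (nonincreasing, multiplicity-counted) sequence of singular values of
    the compact operator f, given through its Schmidt decomposition
    f v = sum_n s_n <v, e_n> u_n *)
Definition singular_values (V W : normedModType R) (ipV : V -> V -> R)
    (ipW : W -> W -> R) (f : V -> W) (s : nat -> R) : Prop :=
  (forall n, 0 <= s n) /\ (forall n, s n.+1 <= s n) /\
  (s n @[n --> \oo] --> 0) /\
  exists (e : nat -> V) (u : nat -> W), orthonormal ipV e /\ orthonormal ipW u /\
    forall v : V,
      (\sum_(n < N) (s n * ipV v (e n)) *: u n) @[N --> \oo] --> f v.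

Definition schatten (p : \bar R) (s : nat -> R) : \bar R :=
  match p with
  | r%:E => match (\sum_(n <oo) ((s n) `^ r)%:E)%E with
            | x%:E => (x `^ r^-1)%:E
            | _ => +oo%E
            end
  | +oo%E => ereal_sup (range (fun n => (s n)%:E))
  | -oo%E => +oo%E
  end.

Definition schatten_ball (V W : normedModType R) (ipV : V -> V -> R)
    (ipW : W -> W -> R) (p : \bar R) (c : R) : set (V -> W) :=
  [set f | exists s, singular_values ipV ipW f s /\ (schatten p s <= c%:E)%E].

Definition sqloss (V W : normedModType R) (f : V -> W) (x : V) (y : W) : R :=
  `|f x - y| ^+ 2.

Definition sgn (b : bool) : R := if b then 1 else -1.

Definition predictable (T : nat) (Z : Type)
    (x : 'I_T -> {ffun 'I_T -> bool} -> Z) : Prop :=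
  forall (t : 'I_T) (s s' : {ffun 'I_T -> bool}),
    (forall i : 'I_T, (i < t)%N -> s i = s' i) -> x t s = x t s'.

Definition seq_rademacher (V W : normedModType R) (X : set V) (Y : set W)
    (T : nat) (F : set (V -> W)) : \bar R :=
  ereal_sup [set r | exists (x : 'I_T -> {ffun 'I_T -> bool} -> V)
                            (y : 'I_T -> {ffun 'I_T -> bool} -> W),
     predictable x /\ predictable y /\
     (forall t s, X (x t s)) /\ (forall t s, Y (y t s)) /\
     r = (((2 ^+ T)^-1 : R)%:E *
          \sum_(s : {ffun 'I_T -> bool})
             ereal_sup [set (\sum_(t < T) sgn (s t) * sqloss f (x t s) (y t s))%:E
                       | f in F])%E].

Definition history (V W : Type) (T : nat) (xy : 'I_T -> V * W) (t : 'I_T)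
  : seq (V * W) := [seq xy i | i <- [seq j <- enum 'I_T | (val j < val t)%N]].

(** a randomized online algorithm: internal randomness omega drawn from a
    probability space; given the history and x_t it predicts in Y *)
Definition valid_algorithm (V W : normedModType R) (Y : set W)
    d (Omega : measurableType d) (A : Omega -> seq (V * W) -> V -> W) : Prop :=
  (forall w h v, Y (A w h v)) /\
  (forall h v y, measurable_fun setT (fun w => `|A w h v - y|)).

Definition regret (V W : normedModType R) (X : set V) (Y : set W)
    d (Omega : measurableType d) (P : probability Omega R)
    (A : Omega -> seq (V * W) -> V -> W) (T : nat) (F : set (V -> W)) : \bar R :=
  ereal_sup [set r | exists xy : 'I_T -> V * W,
     (forall t, X (xy t).1 /\ Y (xy t).2) /\
     r = (\int[P]_w
            ((\sum_(t < T) sqloss (A w (history xy t)) (xy t).1 (xy t).2)%:E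
             - ereal_inf [set (\sum_(t < T) sqloss f (xy t).1 (xy t).2)%:E
                         | f in F]))%E].

Definition minimax_regret (V W : normedModType R) (X : set V) (Y : set W)
    (T : nat) (F : set (V -> W)) : \bar R :=
  ereal_inf [set r | exists d (Omega : measurableType d)
                            (P : probability Omega R)
                            (A : Omega -> seq (V * W) -> V -> W),
     valid_algorithm Y A /\ r = regret X Y P A T F].

(** max{1/2, 1 - 1/p}, with 1/oo = 0 *)
Definition rate_exponent (p : \bar R) : R :=
  match p with
  | r%:E => Num.max (2^-1) (1 - r^-1)
  | _ => 1
  end.

End Defs.

(* Main.v *)
Require Import Defs.
From HB Require Import structures.
From mathcomp Require Import all_boot all_order all_algebra.
From mathcomp Require Import all_classical all_reals all_analysis.
From mathcomp Require Import ring lra.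
Import Order.TTheory GRing.Theory Num.Theory.
Import numFieldNormedType.Exports.
Local Open Scope classical_set_scope.
Local Open Scope ring_scope.

(* Minimax bound. The relaxation rel_k(g) is the value of the k-step tree game whose
   payoff is sup_f (g f + sum of +-2 losses); thus rel_T(0) = 2 Rad_T.  A learner who
   keeps (loss so far) + rel_{remaining}(- sum of past losses) from increasing has
   regret at most rel_T(0).  A suitable prediction exists at each round because the
   square loss is convex: the mean of a nearly worst finitely supported distribution of
   y_t is nearly optimal, so no topological minimax theorem is needed and the algorithm is
   deterministic.

   Rademacher bound. Let B be the span of x_1, ..., x_T.  By Hoelder for the singular
   values, the Hilbert-Schmidt norm of f restricted to B is at most c T^(a - 1/2), where a
   is the rate exponent.  Expanding the square, both sum_t s_t |f x_t|^2 and
   sum_t s_t <f x_t, y_t> have the form sum_t <f x_t, w_t>, which Cauchy-Schwarz in an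
   orthonormal basis of B bounds by that norm times the square root of
   sum_{t,t'} <x_t, x_t'><w_t, w_t'>; the off-diagonal terms have mean zero.  The estimates
   are made for truncated Schmidt sums, and AM-GM replaces the square root. *)

Set Implicit Arguments.
Unset Strict Implicit.

(** * The game relaxation: bounds, monotonicity, convexity *)

Section Relaxation.
Context {R : realType} {H Z : Type}.
Variables (F : set H) (D : set Z) (l : Z -> H -> R) (L : R).
Hypothesis F0 : F !=set0.
Hypothesis D0 : D !=set0.
Hypothesis lL : forall z f, D z -> F f -> 0 <= l z f <= L.

Fixpoint relaxation (k : nat) (g : H -> R) : R :=
  if k is k'.+1 then
    sup [set (relaxation k' (fun f => g f + 2 * l z f)
              + relaxation k' (fun f => g f - 2 * l z f)) / 2 | z in D]
  else sup [set g f | f in F].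

(** The real-valued [sup] returns a default value on a set without upper bound, so a payoff must be
    bounded above before its values can be compared with the supremum. *)
Definition bounded_above_on (g : H -> R) := exists M, forall f, F f -> g f <= M.

(** Whatever its sign, a round raises the payoff by at most [2 * L]. This bounds the sets under the
    suprema in [relaxation]. *)
Lemma relaxation_ub k g M :
  (forall f, F f -> g f <= M) -> relaxation k g <= M + 2 * L * k%:R.
Proof.
elim: k g M => [|k IH] g M gM /=.
  rewrite mulr0 addr0; apply: ge_sup; first by case: F0 => f Ff; exists (g f), f.
  by move=> _ [f Ff <-]; exact: gM.
apply: ge_sup; first by case: D0 => z Dz; eexists; exists z.
move=> _ [z Dz <-].
have h1 : relaxation k (fun f => g f + 2 * l z f) <= M + 2 * L + 2 * L * k%:R.
  by apply: IH => f Ff; have := gM f Ff; have /andP[] := lL Dz Ff; lra.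
have h2 : relaxation k (fun f => g f - 2 * l z f) <= M + 2 * L + 2 * L * k%:R.
  by apply: IH => f Ff; have := gM f Ff; have /andP[] := lL Dz Ff; lra.
rewrite -[k.+1%:R]natr1; lra.
Qed.

Lemma bounded_above_onD g h :
  bounded_above_on g -> bounded_above_on h ->
  bounded_above_on (fun f => g f + h f).
Proof.
by move=> [M gM] [N hN]; exists (M + N) => f Ff; apply: lerD; [exact: gM|exact: hN].
Qed.

Lemma bounded_above_onDl a z g : D z ->
  bounded_above_on g -> bounded_above_on (fun f => g f + a * l z f).
Proof.
move=> Dz gb; apply: bounded_above_onD => //; exists (`|a| * L) => f Ff.
have /andP[l0 lL'] := lL Dz Ff.
apply: le_trans (ler_norm _) _; rewrite normrM (ger0_norm l0).
by apply: ler_wpM2l.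
Qed.

Lemma bounded_above_onBl a z g : D z ->
  bounded_above_on g -> bounded_above_on (fun f => g f - a * l z f).
Proof.
move=> Dz gb; have := @bounded_above_onDl (- a) z g Dz gb.
by under eq_fun do rewrite mulNr.
Qed.

Lemma relaxation_has_ub k g : bounded_above_on g ->
  has_ubound [set (relaxation k (fun f => g f + 2 * l z f)
              + relaxation k (fun f => g f - 2 * l z f)) / 2 | z in D].
Proof.
move=> [M gM]; exists (M + 2 * L + 2 * L * k%:R) => _ [z Dz <-].
have h1 : relaxation k (fun f => g f + 2 * l z f) <= M + 2 * L + 2 * L * k%:R.
  by apply: relaxation_ub => f Ff; have := gM f Ff; have /andP[] := lL Dz Ff; lra.
have h2 : relaxation k (fun f => g f - 2 * l z f) <= M + 2 * L + 2 * L * k%:R.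
  by apply: relaxation_ub => f Ff; have := gM f Ff; have /andP[] := lL Dz Ff; lra.
lra.
Qed.

Lemma relaxation0_ge g f : bounded_above_on g -> F f -> g f <= relaxation 0 g.
Proof.
by move=> [M gM] Ff; apply: ub_le_sup; [exists M => _ [h Fh <-]; exact: gM|exists f].
Qed.

Lemma relaxationS_ge k g z : bounded_above_on g -> D z ->
  (relaxation k (fun f => g f + 2 * l z f)
   + relaxation k (fun f => g f - 2 * l z f)) / 2 <= relaxation k.+1 g.
Proof.
by move=> gb Dz; apply: ub_le_sup; [exact: relaxation_has_ub|exists z].
Qed.

(** Playing the same move against both payoffs carries [C] unchanged through every round, which
    gives monotonicity and the effect of adding a constant together. *)
Lemma le_relaxation k g h C : bounded_above_on h ->
  (forall f, F f -> g f <= h f + C) -> relaxation k g <= relaxation k h + C.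
Proof.
elim: k g h => [|k IH] g h hb gh.
  apply: ge_sup; first by case: F0 => f Ff; exists (g f), f.
  move=> _ [f Ff <-]; apply: le_trans (gh _ Ff) _; rewrite lerD2r.
  exact: relaxation0_ge.
apply: ge_sup; first by case: D0 => z Dz; eexists; exists z.
move=> _ [z Dz <-]; rewrite -/relaxation.
have := @relaxationS_ge k h z hb Dz.
have : relaxation k (fun f => g f + 2 * l z f)
       <= relaxation k (fun f => h f + 2 * l z f) + C.
  by apply: IH => [|f Ff]; [exact: bounded_above_onDl|have := gh f Ff; lra].
have : relaxation k (fun f => g f - 2 * l z f)
       <= relaxation k (fun f => h f - 2 * l z f) + C.
  by apply: IH => [|f Ff]; [exact: bounded_above_onBl|have := gh f Ff; lra].
lra.
Qed.

(** Since the weights sum to one, each increment can be moved inside the weighted sum ([split]);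
    then a supremum of averages is at most the average of the suprema. *)
Lemma relaxation_convex (I : eqType) (r : seq I) (w : I -> R) (g : I -> H -> R) k :
  {in r, forall i, 0 <= w i} -> \sum_(i <- r) w i = 1 ->
  {in r, forall i, bounded_above_on (g i)} ->
  relaxation k (fun f => \sum_(i <- r) w i * g i f)
  <= \sum_(i <- r) w i * relaxation k (g i).
Proof.
move=> w0 w1; elim: k g => [|k IH] g gb.
  apply: ge_sup; first by case: F0 => f Ff; eexists; exists f.
  move=> _ [f Ff <-]; rewrite big_seq [leRHS]big_seq.
  apply: ler_sum => i ir; apply: ler_wpM2l; first exact: w0.
  by apply: relaxation0_ge => //; exact: gb.
apply: ge_sup; first by case: D0 => z Dz; eexists; exists z.
move=> _ [z Dz <-]; rewrite -/relaxation.
have split a : (fun f => \sum_(i <- r) w i * g i f + a * l z f)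
             = (fun f => \sum_(i <- r) w i * (g i f + a * l z f)).
  apply/funext => f; under [RHS]eq_bigr do rewrite mulrDr.
  by rewrite big_split /= -mulr_suml w1 mul1r.
have hp : relaxation k (fun f => \sum_(i <- r) w i * g i f + 2 * l z f)
    <= \sum_(i <- r) w i * relaxation k (fun f => g i f + 2 * l z f).
  by rewrite split; apply: IH => i ir; apply: bounded_above_onDl => //; exact: gb.
have hm : relaxation k (fun f => \sum_(i <- r) w i * g i f - 2 * l z f)
    <= \sum_(i <- r) w i * relaxation k (fun f => g i f - 2 * l z f).
  under eq_fun do rewrite -mulNr; rewrite split.
  under [leRHS]eq_bigr do under eq_fun do rewrite -mulNr.
  by apply: IH => i ir; apply: bounded_above_onDl => //; exact: gb.
have hs : \sum_(i <- r) w i * ((relaxation k (fun f => g i f + 2 * l z f)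
     + relaxation k (fun f => g i f - 2 * l z f)) / 2)
     <= \sum_(i <- r) w i * relaxation k.+1 (g i).
  rewrite big_seq [leRHS]big_seq.
  apply: ler_sum => i ir; apply: ler_wpM2l; first exact: w0.
  by apply: relaxationS_ge => //; exact: gb.
apply: le_trans hs.
under eq_bigr do rewrite mulrA mulrDr.
rewrite -mulr_suml big_split /=.
by apply: ler_wpM2r; [rewrite invr_ge0|exact: lerD].
Qed.

Lemma relaxation_midpoint k g h : bounded_above_on g -> bounded_above_on h ->
  relaxation k (fun f => (g f + h f) / 2) <= (relaxation k g + relaxation k h) / 2.
Proof.
move=> gb hb.
have := @relaxation_convex bool [:: true; false] (fun=> 2^-1)
   (fun b => if b then g else h) k.
rewrite !big_cons !big_nil /= addr0.
have -> : (fun f => \sum_(i <- [:: true; false]) 2^-1 * (if i then g else h) f)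
    = (fun f => (g f + h f) / 2).
  by apply/funext => f; rewrite !big_cons big_nil addr0; lra.
have half0 : {in [:: true; false], forall b : bool, 0 <= 2^-1 :> R} by move=> b _; lra.
have half1 : 2^-1 + 2^-1 = 1 :> R by lra.
move=> /(_ half0 half1) h'; apply: le_trans (h' _) _; last lra.
by case.
Qed.

(* For an independent copy j of i, C <= E_j l_j; convexity moves E_j out of the
   relaxation, and g - l_i + l_j is the midpoint of g - 2 l_i and g + 2 l_j. *)
Lemma relaxation_step (I : eqType) (r : seq I) (w : I -> R) (z : I -> Z) g C k :
  bounded_above_on g -> {in r, forall i, 0 <= w i} -> \sum_(i <- r) w i = 1 ->
  {in r, forall i, D (z i)} ->
  (forall f, F f -> C <= \sum_(i <- r) w i * l (z i) f) ->
  C + \sum_(i <- r) w i * relaxation k (fun f => g f - l (z i) f)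
  <= relaxation k.+1 g.
Proof.
move=> gb w0 w1 Dz hC.
pose A i := relaxation k (fun f => g f + 2 * l (z i) f).
pose B i := relaxation k (fun f => g f - 2 * l (z i) f).
have gbm i : i \in r -> bounded_above_on (fun f => g f - l (z i) f).
  move=> ir; have := @bounded_above_onBl 1 (z i) g (Dz _ ir) gb.
  by under eq_fun do rewrite mul1r.
have gbd i j : i \in r -> j \in r ->
    bounded_above_on (fun f => g f - l (z i) f + l (z j) f).
  move=> ir jr; have := @bounded_above_onDl 1 (z j) _ (Dz _ jr) (gbm _ ir).
  by under eq_fun do rewrite mul1r.
have step i : i \in r -> C + relaxation k (fun f => g f - l (z i) f)
    <= (\sum_(j <- r) w j * A j + B i) / 2.
  move=> ir.
  have h1 : relaxation k (fun f => g f - l (z i) f) <=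
     relaxation k (fun f => \sum_(j <- r) w j * (g f - l (z i) f + l (z j) f)) + - C.
    have [M gM] := gb.
    apply: le_relaxation => [|f Ff].
      exists (\sum_(j <- r) w j * (M + L)) => f Ff.
      rewrite big_seq [leRHS]big_seq; apply: ler_sum => j jr.
      apply: ler_wpM2l; first exact: w0.
      have := gM f Ff; have /andP[] := lL (Dz _ ir) Ff.
      by have /andP[] := lL (Dz _ jr) Ff; lra.
    under [X in _ <= X + _]eq_bigr do rewrite mulrDr.
    by rewrite big_split /= -mulr_suml w1 mul1r; have := hC f Ff; lra.
  have h2 := relaxation_convex k w0 w1 (fun j jr => gbd i j ir jr).
  have h3 : \sum_(j <- r) w j * relaxation k (fun f => g f - l (z i) f + l (z j) f)
      <= \sum_(j <- r) w j * ((A j + B i) / 2).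
    rewrite big_seq [leRHS]big_seq; apply: ler_sum => j jr.
    apply: ler_wpM2l; first exact: w0.
    have -> : (fun f => g f - l (z i) f + l (z j) f)
       = (fun f => ((g f + 2 * l (z j) f) + (g f - 2 * l (z i) f)) / 2).
      by apply/funext => f; lra.
    apply: relaxation_midpoint; last by apply: bounded_above_onBl => //; exact: Dz.
    by apply: bounded_above_onDl => //; exact: Dz.
  have h4 : \sum_(j <- r) w j * ((A j + B i) / 2)
      = (\sum_(j <- r) w j * A j + B i) / 2.
    under eq_bigr do rewrite mulrA mulrDr.
    by rewrite -mulr_suml big_split /= -[X in _ + X]mulr_suml w1 mul1r.
  by rewrite h4 in h3; lra.
have h1 : C + \sum_(i <- r) w i * relaxation k (fun f => g f - l (z i) f)
     <= \sum_(i <- r) w i * ((\sum_(j <- r) w j * A j + B i) / 2).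
  rewrite -[C in leLHS]mul1r -[X in X * C]w1 mulr_suml -big_split /= big_seq [leRHS]big_seq.
  apply: ler_sum => i ir; rewrite -mulrDr; apply: ler_wpM2l; first exact: w0.
  exact: step.
apply: le_trans h1 _.
(* The indices [i] and [j] have the same law, so after averaging [A j] may be renamed [A i]. Both
   branches then belong to one move, as [relaxationS_ge] requires. *)
have -> : \sum_(i <- r) w i * ((\sum_(j <- r) w j * A j + B i) / 2)
    = \sum_(i <- r) w i * ((A i + B i) / 2).
  transitivity ((\sum_(j <- r) w j * A j + \sum_(j <- r) w j * B j) / 2).
    under eq_bigr do rewrite mulrA mulrDr.
    by rewrite -mulr_suml big_split /= -[X in X + _]mulr_suml w1 mul1r.
  under [RHS]eq_bigr do rewrite mulrA mulrDr.
  by rewrite -mulr_suml big_split.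
rewrite -[leRHS]mul1r -[X in _ <= X * _]w1 mulr_suml big_seq [leRHS]big_seq.
apply: ler_sum => i ir; apply: ler_wpM2l; first exact: w0.
by apply: relaxationS_ge => //; exact: Dz.
Qed.

End Relaxation.

(** * Inner product identities and the minimax property of the square loss *)

Section InnerProduct.
Context {R : realType} {V : normedModType R} {ip : V -> V -> R}.
Hypothesis ipP : inner_product_for ip.

Lemma ipC u v : ip u v = ip v u.
Proof. by case: ipP. Qed.

Lemma ipDl u v w : ip (u + v) w = ip u w + ip v w.
Proof. by case: ipP => _ [lin _]; have := lin 1 u v w; rewrite scale1r mul1r. Qed.

Lemma ip0l w : ip 0 w = 0.
Proof. by have := ipDl 0 0 w; rewrite addr0; lra. Qed.

Lemma ipZl (a : R) u w : ip (a *: u) w = a * ip u w.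
Proof. by case: ipP => _ [lin _]; have := lin a u 0 w; rewrite addr0 ip0l addr0. Qed.

Lemma ipNl u w : ip (- u) w = - ip u w.
Proof. by rewrite -scaleN1r ipZl mulN1r. Qed.

Lemma ipBl u v w : ip (u - v) w = ip u w - ip v w.
Proof. by rewrite ipDl ipNl. Qed.

Lemma ip0r w : ip w 0 = 0.
Proof. by rewrite ipC ip0l. Qed.

Lemma ipDr u v w : ip w (u + v) = ip w u + ip w v.
Proof. by rewrite ipC ipDl !(ipC w). Qed.

Lemma ipZr (a : R) u w : ip w (a *: u) = a * ip w u.
Proof. by rewrite ipC ipZl (ipC w). Qed.

Lemma ipBr u v w : ip w (u - v) = ip w u - ip w v.
Proof. by rewrite ipC ipBl !(ipC w). Qed.

Lemma ip_suml (I : Type) (r : seq I) (P : pred I) (F : I -> V) w :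
  ip (\sum_(i <- r | P i) F i) w = \sum_(i <- r | P i) ip (F i) w.
Proof. by apply: (big_morph (ip^~ w)) => [u v|]; [exact: ipDl|exact: ip0l]. Qed.

Lemma ip_sumr (I : Type) (r : seq I) (P : pred I) (F : I -> V) w :
  ip w (\sum_(i <- r | P i) F i) = \sum_(i <- r | P i) ip w (F i).
Proof. by rewrite ipC ip_suml; apply: eq_bigr => i _; rewrite ipC. Qed.

Lemma ip_norm v : ip v v = `|v| ^+ 2.
Proof. by case: ipP => _ [_ ->]. Qed.

Lemma sqr_normD u v : `|u + v| ^+ 2 = `|u| ^+ 2 + 2 * ip u v + `|v| ^+ 2.
Proof. by rewrite -!ip_norm !ipDl !ipDr (ipC v u); ring. Qed.

Lemma sqr_normB u v : `|u - v| ^+ 2 = `|u| ^+ 2 - 2 * ip u v + `|v| ^+ 2.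
Proof. by rewrite -!ip_norm !ipBl !ipBr (ipC v u); ring. Qed.

Lemma sqr_normZ (a : R) (v : V) : `|a *: v| ^+ 2 = a ^+ 2 * `|v| ^+ 2.
Proof. by rewrite -!ip_norm ipZl ipZr; ring. Qed.

(** Expand the square of the norm of [a *: u - v], which is nonnegative, and divide by [a]. The free
    scale [a] is tuned in the Rademacher bound. *)
Lemma ip_young (a : R) (u v : V) : 0 < a -> 2 * ip u v <= a * `|u| ^+ 2 + a^-1 * `|v| ^+ 2.
Proof.
move=> a0.
have : 0 <= `|a *: u - v| ^+ 2 by exact: sqr_ge0.
rewrite sqr_normB sqr_normZ ipZl => h.
have : 0 <= a^-1 * (a ^+ 2 * `|u| ^+ 2 - 2 * (a * ip u v) + `|v| ^+ 2).
  by apply: mulr_ge0 => //; rewrite invr_ge0 ltW.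
suff -> : a^-1 * (a ^+ 2 * `|u| ^+ 2 - 2 * (a * ip u v) + `|v| ^+ 2)
   = a * `|u| ^+ 2 - 2 * ip u v + a^-1 * `|v| ^+ 2 by lra.
by field; rewrite gt_eqF.
Qed.

(** The two sides differ by the squared distance from [v] to the mean. Hence the variance is a lower
    bound for the expected loss of every comparator, and it serves as the [C] of
    [relaxation_step]. *)
Lemma variance_le (r : seq (R * V)) (v : V) : \sum_(q <- r) q.1 = 1 ->
  \sum_(q <- r) q.1 * `|q.2| ^+ 2 - `|\sum_(q <- r) q.1 *: q.2| ^+ 2
  <= \sum_(q <- r) q.1 * `|v - q.2| ^+ 2.
Proof.
move=> w1; set m := \sum_(q <- r) q.1 *: q.2.
have -> : \sum_(q <- r) q.1 * `|v - q.2| ^+ 2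
    = `|v| ^+ 2 - 2 * ip v m + \sum_(q <- r) q.1 * `|q.2| ^+ 2.
  under eq_bigr do rewrite sqr_normB mulrDr mulrBr.
  rewrite big_split /= sumrB -mulr_suml w1 mul1r /m ip_sumr mulr_sumr.
  congr (_ - _ + _); apply: eq_bigr => q _; rewrite ipZr; ring.
have : 0 <= `|v - m| ^+ 2 by exact: sqr_ge0.
rewrite sqr_normB; lra.
Qed.

Variable c : R.
Hypothesis c0 : 0 < c.
Let Y := [set w : V | `|w| <= c].

(** Lists of weighted points encode finitely supported laws; mixing with a point mass is then
    rescaling and consing. *)
Definition distribution_on (r : seq (R * V)) :=
  {in r, forall q, 0 <= q.1 /\ Y q.2} /\ \sum_(q <- r) q.1 = 1.

Lemma mean_in_ball r : distribution_on r -> Y (\sum_(q <- r) q.1 *: q.2).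
Proof.
move=> [rY r1]; rewrite /Y /=; apply: le_trans (ler_norm_sum _ _ _) _.
rewrite -[c]mul1r -[X in X * c]r1 mulr_suml big_seq [leRHS]big_seq.
apply: ler_sum => q qr; have [q0 qY] := rY _ qr.
by rewrite normrZ (ger0_norm q0); apply: ler_wpM2l.
Qed.

(* The mean m of a nearly optimal distribution r is a nearly optimal
   prediction: moving mass t from r to a point mass at y changes the value to
   first order by t (|m - y|^2 + h y - value). *)
Lemma minimax_square (h : V -> R) (S : R) :
  (forall r, distribution_on r ->
     \sum_(q <- r) q.1 * `|q.2| ^+ 2 - `|\sum_(q <- r) q.1 *: q.2| ^+ 2
     + \sum_(q <- r) q.1 * h q.2 <= S) ->
  forall eps, 0 < eps ->
  exists m, Y m /\ forall y, Y y -> `|m - y| ^+ 2 + h y <= S + eps.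
Proof.
move=> hS eps e0.
(* [Psi r] is the value of the round against [r] when the learner answers with the best prediction,
   the mean. *)
pose Psi r := \sum_(q <- r) q.1 * `|q.2| ^+ 2 - `|\sum_(q <- r) q.1 *: q.2| ^+ 2
     + \sum_(q <- r) q.1 * h q.2.
pose E := [set Psi r | r in distribution_on].
have supE : has_sup E.
  split; last by exists S => _ [r rD <-]; exact: hS.
  exists (Psi [:: (1, 0)]), [:: (1, 0)] => //; split; last by rewrite big_seq1.
  by move=> q; rewrite inE => /eqP -> /=; split=> //; rewrite /Y /= normr0 ltW.
(* The error will be [t], from the near-optimality slack [t ^+ 2] divided by [t], plus at most
   [t * (4 * c ^+ 2)], from the factor [1 - t]. By [tE] the total is at most [eps], and the summand
   [eps] in the denominator keeps [t < 1]. *)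
pose t := eps / (1 + 4 * c ^+ 2 + eps).
have D0 : 0 < 1 + 4 * c ^+ 2 + eps by have := sqr_ge0 c; lra.
have t0 : 0 < t by exact: divr_gt0.
have t1 : t < 1 by rewrite ltr_pdivrMr // mul1r; have := sqr_ge0 c; lra.
have tE : t * (1 + 4 * c ^+ 2) <= eps.
  have : t * (1 + 4 * c ^+ 2 + eps) = eps by rewrite /t divfK // gt_eqF.
  by have := mulr_ge0 (ltW t0) (ltW e0); lra.
have [_ [r rD <-] rE] := sup_adherent (exprn_gt0 2 t0) supE.
exists (\sum_(q <- r) q.1 *: q.2); split; first exact: mean_in_ball.
move=> y yY; set m := \sum_(q <- r) q.1 *: q.2.
have [rY r1] := rD.
pose r' := (t, y) :: [seq ((1 - t) * q.1, q.2) | q <- r].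
have r'D : distribution_on r'.
  split; last by rewrite big_cons big_map /= -mulr_sumr r1; ring.
  move=> q; rewrite inE => /orP[/eqP -> /=|/mapP[q' q'r -> /=]].
    by split=> //; exact: ltW.
  have [? ?] := rY _ q'r; split=> //; apply: mulr_ge0 => //; lra.
have h1 : Psi r' < Psi r + t ^+ 2.
  have : Psi r' <= sup E by apply: ub_le_sup; [exact: supE.2|exists r'].
  by move: rE; lra.
have sumE (G : V -> R) : \sum_(q <- r') q.1 * G q.2
    = t * G y + (1 - t) * \sum_(q <- r) q.1 * G q.2.
  rewrite big_cons big_map /= mulr_sumr; congr (_ + _).
  by apply: eq_bigr => q _; rewrite mulrA.
have meanE : \sum_(q <- r') q.1 *: q.2 = t *: y + (1 - t) *: m.
  rewrite big_cons big_map /= scaler_sumr; congr (_ + _).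
  by apply: eq_bigr => q _; rewrite scalerA.
(* Law of total variance: the point mass has no variance of its own, and the last term is the
   variance between the two components. *)
have h2 : Psi r' = (1 - t) * Psi r + t * h y + t * (1 - t) * `|m - y| ^+ 2.
  rewrite /Psi (sumE (fun v => `|v| ^+ 2)) (sumE h) meanE -/m.
  rewrite sqr_normD !sqr_normZ ipZl ipZr sqr_normB (ipC m y); ring.
have d4 : `|m - y| ^+ 2 <= 4 * c ^+ 2.
  have -> : 4 * c ^+ 2 = (c + c) ^+ 2 by ring.
  rewrite ler_pXn2r ?nnegrE ?addr_ge0 ?(ltW c0) //.
  apply: le_trans (ler_normB _ _) _; apply: lerD => //; exact: mean_in_ball.
have h3 : h y + (1 - t) * `|m - y| ^+ 2 < Psi r + t.
  rewrite -(ltr_pM2l t0); move: h1; rewrite h2; lra.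
have h4 : t * `|m - y| ^+ 2 <= t * (4 * c ^+ 2) by rewrite ler_pM2l.
have := hS r rD; rewrite -/(Psi r); lra.
Qed.

End InnerProduct.

(** * The online algorithm and its regret *)

Section OnlineAlgorithm.
Context {R : realType} {V W : normedModType R} {ip : W -> W -> R}.
Hypothesis ipP : inner_product_for ip.
Variables (c : R) (X : set V) (F : set (V -> W)).
Hypothesis c0 : 0 < c.
Hypothesis X0 : X !=set0.
Hypothesis F0 : F !=set0.
Hypothesis FX : forall f x, F f -> X x -> `|f x| <= c.
Let Y := [set w : W | `|w| <= c].
Let D := [set z : V * W | X z.1 /\ Y z.2].
Let loss (z : V * W) (f : V -> W) : R := sqloss f z.1 z.2.
Let rel := relaxation F D loss.

Lemma game_moves_neq0 : D !=set0.
Proof. by case: X0 => x Xx; exists (x, 0); split=> //; rewrite /Y /= normr0 ltW. Qed.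

Lemma loss_bounded z f : D z -> F f -> 0 <= loss z f <= 4 * c ^+ 2.
Proof.
move=> [Xz Yz] Ff; rewrite /loss /sqloss sqr_ge0 /=.
have -> : 4 * c ^+ 2 = (c + c) ^+ 2 by ring.
rewrite ler_pXn2r ?nnegrE ?addr_ge0 ?(ltW c0) //.
by apply: le_trans (ler_normB _ _) _; apply: lerD => //; exact: FX.
Qed.

Definition good_prediction k g x eps (m : W) := Y m /\ forall y, Y y ->
  `|m - y| ^+ 2 + rel k (fun f => g f - loss (x, y) f) <= rel k.+1 g + eps.

(** Apply [minimax_square] with [h] the value of the remaining game. Its hypothesis is
    [relaxation_step] with [C] the variance, which no value [f x] can beat on average. *)
Lemma exists_good_prediction k g x eps : bounded_above_on F g -> X x -> 0 < eps ->
  exists m, good_prediction k g x eps m.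
Proof.
move=> gb Xx e0.
apply: (minimax_square ipP c0 (h := fun y => rel k (fun f => g f - loss (x, y) f)))
  => // r [rY r1].
apply: (relaxation_step F0 game_moves_neq0 loss_bounded k
          (w := fst) (z := fun q => (x, q.2))) => //.
- by move=> q /rY[].
- by move=> q /rY[].
- by move=> f Ff; apply: (le_trans (variance_le ipP (f x) r1)).
Qed.

(** The number [(T - size h).-1] counts the rounds left after the present one. The default [0] lies
    in [Y], so predictions are legal even on inputs outside the game. *)
Definition relaxation_algorithm T eps (h : seq (V * W)) (x : V) : W :=
  xget 0 (good_prediction (T - size h).-1 (fun f => - \sum_(z <- h) loss z f) x eps).

Lemma relaxation_algorithm_in_ball T eps h x : Y (relaxation_algorithm T eps h x).
Proof.
rewrite /relaxation_algorithm; case: xgetP => [y _ []//|_].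
by rewrite /Y /= normr0 ltW.
Qed.

Section Run.
Variables (T : nat) (xy : 'I_T -> V * W).
Hypothesis xyD : forall t, D (xy t).

Lemma sum_history (t : 'I_T) (G : V * W -> R) :
  \sum_(z <- history xy t) G z = \sum_(i < T | (i < t)%N) G (xy i).
Proof. by rewrite /history big_map big_filter big_enum_cond. Qed.

Lemma size_history (t : 'I_T) : size (history xy t) = t.
Proof.
rewrite /history size_map size_filter -sum1_count big_enum_cond /=.
by rewrite -[RHS]card_ord -sum1_card; apply/esym/(big_ord_widen T (fun=> 1%N))/ltnW.
Qed.

Lemma sum_ltnS n (G : 'I_T -> R) (nT : (n < T)%N) :
  \sum_(i < T | (i < n.+1)%N) G i = \sum_(i < T | (i < n)%N) G i + G (Ordinal nT).
Proof.
rewrite (bigD1 (Ordinal nT)) /= ?ltnS // addrC; congr (_ + _).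
by apply: eq_bigl => i; rewrite ltnS -val_eqE /= ltn_neqAle andbC.
Qed.

Lemma cumulative_loss_bounded n :
  bounded_above_on F (fun f => - \sum_(i < T | (i < n)%N) loss (xy i) f).
Proof.
exists 0 => f Ff; rewrite oppr_le0; apply: sumr_ge0 => i _.
by have /andP[] := loss_bounded (xyD i) Ff.
Qed.

(** The left side is a potential that each good prediction lets grow by at most [eps]. At [n = T]
    the relaxation has no rounds left and is the supremum of minus the comparator losses. *)
Lemma relaxation_algorithm_prefix eps n : 0 < eps -> (n <= T)%N ->
  \sum_(t < T | (t < n)%N)
     `|relaxation_algorithm T eps (history xy t) (xy t).1 - (xy t).2| ^+ 2
  + rel (T - n) (fun f => - \sum_(i < T | (i < n)%N) loss (xy i) f)
  <= rel T (fun=> 0) + eps * n%:R.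
Proof.
move=> e0; elim: n => [|n IH] nT.
  rewrite big_pred0 // add0r subn0 mulr0 addr0.
  by under eq_fun do rewrite big_pred0 // oppr0.
have := IH (ltnW nT); rewrite sum_ltnS.
set S := \sum_(t < T | _) _; pose t := Ordinal nT; rewrite -/t.
set g := fun f => - _ => IHn.
have gE : (fun f => - \sum_(i < T | (i < n.+1)%N) loss (xy i) f)
    = (fun f => g f - loss ((xy t).1, (xy t).2) f).
  by apply/funext => f; rewrite sum_ltnS opprD -surjective_pairing.
have [Xt Yt] := xyD t.
have gb : bounded_above_on F g by exact: cumulative_loss_bounded.
have : good_prediction (T - n.+1) g (xy t).1 eps
         (relaxation_algorithm T eps (history xy t) (xy t).1).
  rewrite /relaxation_algorithm size_history /= -subnS.
  have -> : (fun f => - \sum_(z <- history xy t) loss z f) = g.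
    by apply/funext => f; rewrite sum_history.
  have [m hm] := exists_good_prediction (T - n.+1) gb Xt e0.
  by apply: xgetPex; exists m.
move=> [_ /(_ _ Yt)]; rewrite gE.
have -> : (T - n.+1).+1 = (T - n)%N by rewrite subnSK.
rewrite -[n.+1%:R]natr1; lra.
Qed.

Lemma relaxation_algorithm_regret eps f : 0 < eps -> F f ->
  \sum_(t < T) `|relaxation_algorithm T eps (history xy t) (xy t).1 - (xy t).2| ^+ 2
  <= \sum_(t < T) loss (xy t) f + (rel T (fun=> 0) + eps * T%:R).
Proof.
move=> e0 Ff; have := relaxation_algorithm_prefix e0 (leqnn T).
have allT (G : 'I_T -> R) : \sum_(t < T | (t < T)%N) G t = \sum_(t < T) G t.
  by apply: eq_bigl => t; rewrite ltn_ord.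
rewrite allT subnn.
have := relaxation0_ge D loss (cumulative_loss_bounded T) Ff.
rewrite allT /rel; lra.
Qed.

End Run.

Lemma minimax_regret_le_relaxation T :
  (minimax_regret X Y T F <= (rel T (fun=> 0))%:E)%E.
Proof.
apply/lee_addgt0Pr => eps e0.
(* The slack per round, totalling at most [eps]; [T.+1] avoids a zero denominator when [T = 0]. *)
pose d := eps / T.+1%:R.
have d0 : 0 < d by exact: divr_gt0.
have dT : d * T%:R <= eps.
  by rewrite /d mulrAC ler_pdivrMr // ler_pM2l // ler_nat.
(* A deterministic algorithm is run on the one-point probability space, where the expectation is the
   constant itself. *)
pose A (_ : unit) := relaxation_algorithm T d.
apply: (@le_trans _ _ (regret X Y (\d_tt : probability _ R) A T F)).
  apply: ereal_inf_lbound; exists _, unit, \d_tt, A; split=> //.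
  split=> [w h v|h v y]; first exact: relaxation_algorithm_in_ball.
  exact: measurable_cst.
apply: ge_ereal_sup => _ [xy [xyD ->]].
set S := \sum_(t < T) `|relaxation_algorithm T d (history xy t) (xy t).1 - (xy t).2| ^+ 2.
set I := ereal_inf [set (\sum_(t < T) sqloss f (xy t).1 (xy t).2)%:E | f in F].
rewrite (_ : integral _ _ _ = (S%:E - I) * \d_tt setT)%E; last exact: integral_cst.
rewrite probability_setT mule1.
(* This is the regret bound with the subtraction moved across; it also excludes the value -oo for
   [I], which would make the regret infinite. *)
have hI : ((S - (rel T (fun=> 0) + eps))%:E <= I)%E.
  apply: le_ereal_inf_tmp => _ [f Ff <-]; rewrite lee_fin.
  have := relaxation_algorithm_regret xyD d0 Ff; rewrite -/S /loss; lra.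
case: I hI => [r| |] hI.
- by rewrite -EFinD lee_fin; move: hI; rewrite lee_fin; lra.
- by rewrite leNye.
- by move: hI; rewrite leeNy_eq.
Qed.

End OnlineAlgorithm.

(** * Flipping one coordinate of a sign sequence *)

Section CoordinateFlip.
Context {R : realType} {T : nat}.
Implicit Types (t : 'I_T) (s : {ffun 'I_T -> bool}).

Definition flip t s : {ffun 'I_T -> bool} := [ffun i => if i == t then ~~ s i else s i].

Lemma flipK t : involutive (flip t).
Proof.
by move=> s; apply/ffunP => i; rewrite !ffunE; case: eqP => // _; rewrite negbK.
Qed.

Lemma flip_at t s : flip t s t = ~~ s t.
Proof. by rewrite ffunE eqxx. Qed.

Lemma flip_lt t s (i : 'I_T) : (i < t)%N -> flip t s i = s i.
Proof. by move=> it; rewrite ffunE -val_eqE /= ltn_eqF. Qed.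

Lemma sum_flip t (G : {ffun 'I_T -> bool} -> R) : \sum_s G (flip t s) = \sum_s G s.
Proof. by rewrite [RHS](reindex_inj (inv_inj (flipK t))). Qed.

(** Paired with its flip, each term cancels. This replaces the independence of a sign from whatever
    does not depend on it. *)
Lemma sum_sgn_flip t (G : {ffun 'I_T -> bool} -> R) :
  (forall s, G (flip t s) = G s) -> \sum_(s : {ffun 'I_T -> bool}) sgn (s t) * G s = 0.
Proof.
move=> Gt; have := sum_flip t (fun s => sgn (s t) * G s).
have -> : \sum_(s : {ffun 'I_T -> bool}) sgn (flip t s t) * G (flip t s) = - \sum_(s : {ffun 'I_T -> bool}) sgn (s t) * G s.
  rewrite -sumrN; apply: eq_bigr => s _; rewrite Gt flip_at -mulNr; congr (_ * _).
  by rewrite /sgn; case: (s t); rewrite //= opprK.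
by lra.
Qed.

(** The case [i = t] is included because a predictable [x t] does not see its own sign. *)
Lemma predictable_flip (Z : Type) (x : 'I_T -> {ffun 'I_T -> bool} -> Z) (i t : 'I_T) s :
  predictable x -> (i <= t)%N -> x i (flip t s) = x i s.
Proof. by move=> xP it; apply: xP => j ji; apply: flip_lt; exact: leq_trans ji it. Qed.

End CoordinateFlip.

(** * The relaxation is at most twice the sequential Rademacher complexity *)

Section RelaxationRademacher.
Context {R : realType} {V W : normedModType R}.
Variables (X : set V) (Y : set W) (F : set (V -> W)) (L : R).
Let D := [set z : V * W | X z.1 /\ Y z.2].
Let loss (z : V * W) (f : V -> W) : R := sqloss f z.1 z.2.
Let rel := relaxation F D loss.
Hypothesis F0 : F !=set0.
Hypothesis D0 : D !=set0.
Hypothesis lossL : forall z f, D z -> F f -> 0 <= loss z f <= L.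
Variables (T : nat) (z0 : V * W) (eps : R).
Hypothesis z0D : D z0.
Hypothesis e0 : 0 < eps.

(** The supremum over moves need not be attained, hence the slack [eps]. The default [z0] is in [D],
    so the move is legal for every [g]. *)
Definition near_optimal_move k g : V * W := xget z0 [set z | D z /\
  rel k.+1 g <= (rel k (fun f => g f + 2 * loss z f)
                 + rel k (fun f => g f - 2 * loss z f)) / 2 + eps].

Lemma near_optimal_move_in k g : D (near_optimal_move k g).
Proof. by rewrite /near_optimal_move; case: xgetP => // y _ []. Qed.

Lemma near_optimal_moveP k g (z := near_optimal_move k g) : bounded_above_on F g ->
  rel k.+1 g <= (rel k (fun f => g f + 2 * loss z f)
                 + rel k (fun f => g f - 2 * loss z f)) / 2 + eps.
Proof.
move=> gb; rewrite /z {z} /near_optimal_move.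
set P := [set z | _ /\ _].
suff [z Pz] : exists z, P z by have [] := @xgetPex _ z0 P (ex_intro _ z Pz).
have hS : has_sup [set (rel k (fun f => g f + 2 * loss z f)
                 + rel k (fun f => g f - 2 * loss z f)) / 2 | z in D].
  split; first by case: D0 => z Dz; eexists; exists z.
  by apply: (@relaxation_has_ub _ _ _ F D loss L) => //.
have [_ [z Dz <-] hz] := sup_adherent e0 hS.
exists z; split=> //; move: hz; rewrite ltrBlDr; exact: ltW.
Qed.

Implicit Type s : {ffun 'I_T -> bool}.

Definition bit s n : bool := if insub n is Some i then s i else true.

(** The payoff accumulated along the path [s] when every move is nearly optimal. The moves met on
    the way form the tree that witnesses the Rademacher supremum. *)
Fixpoint state s n : (V -> W) -> R :=
  if n is n'.+1 then
    fun f => state s n' f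
             + 2 * (sgn (bit s n') * loss (near_optimal_move (T - n) (state s n')) f)
  else fun=> 0.

Definition move_tree (t : 'I_T) s := near_optimal_move (T - t.+1) (state s t).

Lemma bit_ord s (t : 'I_T) : bit s t = s t.
Proof. by rewrite /bit valK. Qed.

Lemma eq_state s s' n : (forall i : 'I_T, (i < n)%N -> s i = s' i) ->
  state s n = state s' n.
Proof.
elim: n => //= n IH ss'; rewrite IH; last by move=> i /ltnW; exact: ss'.
suff -> : bit s n = bit s' n by [].
by rewrite /bit; case: insubP => // i _ ni; apply: ss'; rewrite ni.
Qed.

Lemma move_tree_predictable : predictable move_tree.
Proof. by move=> t s s' ss'; rewrite /move_tree (eq_state ss'). Qed.

Lemma state_bounded s n : bounded_above_on F (state s n).
Proof.
elim: n => [|n IH] /=; first by exists 0.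
under eq_fun do rewrite mulrA.
by apply: (bounded_above_onDl lossL) => //; exact: near_optimal_move_in.
Qed.

Lemma state_sum s f :
  state s T f = 2 * \sum_(t < T) sgn (s t) * loss (move_tree t s) f.
Proof.
suff H n : (n <= T)%N -> state s n f
    = 2 * \sum_(t < T | (t < n)%N) sgn (s t) * loss (move_tree t s) f.
  by rewrite H //; congr (2 * _); apply: eq_bigl => t; rewrite ltn_ord.
elim: n => [|n IH] nT; first by rewrite big_pred0 // mulr0.
by rewrite sum_ltnS mulrDr /= IH ?(ltnW nT) // -(bit_ord s (Ordinal nT)).
Qed.

(** The state before round [n] does not see the sign at [n], so a path and its flip follow the two
    branches of one move. Near-optimality costs [eps] on each of the [2 ^+ T] paths. *)
Lemma sum_state_step n : (n < T)%N ->
  \sum_s rel (T - n) (state s n)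
  <= \sum_s rel (T - n.+1) (state s n.+1) + (2 ^+ T) * eps.
Proof.
move=> nT; pose t := Ordinal nT; pose k := (T - n.+1)%N.
pose z s := near_optimal_move k (state s n).
pose A s := rel k (fun f => state s n f + 2 * loss (z s) f).
pose B s := rel k (fun f => state s n f - 2 * loss (z s) f).
pose C s := rel k (state s n.+1).
have CE s : C s = if s t then A s else B s.
  rewrite /C /A /B /= -[n]/(nat_of_ord t) bit_ord /sgn -/(z s).
  case: (s t); congr (rel k _); apply/funext => f; rewrite ?mul1r //.
  by rewrite mulN1r mulrN.
have flipE s : state (flip t s) n = state s n.
  by apply: eq_state => i it; exact: flip_lt.
have CC s : C s + C (flip t s) = A s + B s.
  rewrite !CE flip_at /A /B /z flipE; case: (s t) => //=; exact: addrC.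
have -> : \sum_s rel (T - n.+1) (state s n.+1) = \sum_s (A s + B s) / 2.
  rewrite -mulr_suml -(eq_bigr _ (fun s _ => CC s)).
  rewrite big_split /= (sum_flip t C) -/k -/C; lra.
have -> : 2 ^+ T * eps = \sum_(s : {ffun 'I_T -> bool}) eps.
  by rewrite sumr_const cardT -cardE card_ffun card_bool card_ord -natrX mulr_natl.
rewrite -big_split /=; apply: ler_sum => s _.
rewrite -subnSK //; apply: near_optimal_moveP; exact: state_bounded.
Qed.

Lemma relaxation_le_sum_state n : (n <= T)%N ->
  2 ^+ T * rel T (fun=> 0) <= \sum_s rel (T - n) (state s n) + 2 ^+ T * eps * n%:R.
Proof.
elim: n => [|n IH] nT.
  rewrite subn0 mulr0 addr0 /= sumr_const cardT -cardE card_ffun card_bool card_ord.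
  by rewrite -[X in _ <= X]mulr_natl natrX.
have := IH (ltnW nT); have := sum_state_step nT.
rewrite -[n.+1%:R]natr1; lra.
Qed.

Lemma relaxation_le_rademacher_eps :
  ((rel T (fun=> 0) - eps * T%:R)%:E <= 2%:E * seq_rademacher X Y T F)%E.
Proof.
pose U s := ereal_sup [set (\sum_(t < T) sgn (s t)
      * sqloss f (move_tree t s).1 (move_tree t s).2)%:E | f in F].
(* A real [sup] is compared with an extended one: the value +oo of [U s] is harmless, and -oo is
   impossible because [F] is nonempty. *)
have hU s : ((rel 0 (state s T) / 2)%:E <= U s)%E.
  have ub f : F f -> ((state s T f / 2)%:E <= U s)%E.
    move=> Ff; rewrite state_sum mulrC mulKf //; apply: ereal_sup_ubound; exists f => //.
  have [f0 Ff0] := F0.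
  case: (U s) ub => [r| |] ub; [|by rewrite leey|by have := ub _ Ff0; rewrite leeNy_eq].
  rewrite lee_fin ler_pdivrMr //; apply: ge_sup; first by exists (state s T f0), f0.
  by move=> _ [f Ff <-]; rewrite -ler_pdivrMr // -lee_fin; exact: ub.
have T0 : 0 < 2 ^+ T :> R by rewrite exprn_gt0.
have hR : (((2 ^+ T)^-1 : R)%:E * \sum_s U s <= seq_rademacher X Y T F)%E.
  apply: ereal_sup_ubound.
  exists (fun t s => (move_tree t s).1), (fun t s => (move_tree t s).2).
  split; first by move=> t s s' ss'; rewrite (move_tree_predictable ss').
  split; first by move=> t s s' ss'; rewrite (move_tree_predictable ss').
  by split; [|split=> //] => t s; case: (near_optimal_move_in (T - t.+1) (state s t)).
have h1 : ((((2 ^+ T)^-1 : R) * \sum_s (rel 0 (state s T) / 2))%:E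
    <= ((2 ^+ T)^-1 : R)%:E * \sum_s U s)%E.
  rewrite EFinM; apply: lee_wpmul2l; first by rewrite lee_fin invr_ge0 ltW.
  by rewrite -sumEFin; apply: lee_sum => s _; exact: hU.
apply: (@le_trans _ _ (2%:E * (((2 ^+ T)^-1 : R) * \sum_s (rel 0 (state s T) / 2))%:E)%E).
  rewrite -EFinM lee_fin -mulr_suml -(ler_pM2l T0).
  have := relaxation_le_sum_state (leqnn T); rewrite subnn.
  set S := \sum_s _.
  have -> : 2 ^+ T * (2 * ((2 ^+ T)^-1 * (S / 2))) = S by field; rewrite gt_eqF.
  lra.
by apply: lee_wpmul2l; [rewrite lee_fin|exact: le_trans h1 hR].
Qed.

End RelaxationRademacher.

Lemma relaxation_le_rademacher (R : realType) (V W : normedModType R)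
    (X : set V) (Y : set W) (F : set (V -> W)) (L : R) (T : nat)
    (D := [set z : V * W | X z.1 /\ Y z.2])
    (loss := fun (z : V * W) (f : V -> W) => sqloss f z.1 z.2) :
  F !=set0 -> D !=set0 -> (forall z f, D z -> F f -> 0 <= loss z f <= L) ->
  ((relaxation F D loss T (fun=> 0))%:E <= 2%:E * seq_rademacher X Y T F)%E.
Proof.
move=> F0 D0 lossL; have [z0 z0D] := D0.
apply/lee_addgt0Pr => eps e0.
pose d := eps / T.+1%:R.
have d0 : 0 < d by exact: divr_gt0.
have dT : d * T%:R <= eps.
  by rewrite /d mulrAC ler_pdivrMr // ler_pM2l // ler_nat.
have := relaxation_le_rademacher_eps F0 D0 lossL T z0D d0.
set Q := (2%:E * _)%E; rewrite -leeBlDr // -EFinB; apply: le_trans.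
by rewrite lee_fin; lra.
Qed.

(** * Inequalities of Hoelder type for singular values *)

Section SchattenSequences.
Context {R : realType}.
Variables (s : nat -> R) (c : R).
Hypothesis s0 : forall n, 0 <= s n.
Hypothesis c0 : 0 < c.

(** A divergent series makes [schatten] equal to +oo, so the hypothesis leaves only a real sum [S],
    for which the power [r] undoes the root. *)
Lemma schatten_partial_sum (r : R) N : 0 < r ->
  (schatten r%:E s <= c%:E)%E -> \sum_(n < N) s n `^ r <= c `^ r.
Proof.
move=> r0 /=.
have part_le : ((\sum_(n < N) s n `^ r)%:E <= \sum_(n <oo) ((s n) `^ r)%:E)%E.
  rewrite -sumEFin -(big_mkord xpredT (fun n => ((s n) `^ r)%:E)).
  by apply: nneseries_lim_ge => n _ _; rewrite lee_fin powR_ge0.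
case: (\sum_(n <oo) _)%E part_le => [S| |] //; rewrite !lee_fin => NS Sc.
apply: le_trans NS _.
have [S0|S0] := leP S 0; first exact: le_trans S0 (powR_ge0 _ _).
have -> : S = (S `^ r^-1) `^ r by rewrite -powRrM mulVf ?gt_eqF // powRr1 // ltW.
by apply: ge0_ler_powR; rewrite ?nnegrE ?powR_ge0 // ltW.
Qed.

Lemma schatten_sv_le (p : \bar R) n : (1 <= p)%E ->
  (schatten p s <= c%:E)%E -> s n <= c.
Proof.
case: p => [r| |] // r1 hs.
  have r0 : 0 < r by rewrite lee_fin in r1; exact: lt_le_trans r1.
  rewrite leNgt; apply/negP => cs.
  have : c `^ r < s n `^ r by apply: gt0_ltr_powR; rewrite ?nnegrE // ltW.
  rewrite ltNge => /negP; apply; apply: le_trans (schatten_partial_sum n.+1 r0 hs).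
  by rewrite big_ord_recr /= lerDr; apply: sumr_ge0 => i _; exact: powR_ge0.
by rewrite -lee_fin; apply: le_trans hs; apply: ereal_sup_ubound; exists n.
Qed.

Variables (T : nat) (N : nat) (w : nat -> R).
Hypothesis T0 : (0 < T)%N.
Hypothesis w01 : forall n, 0 <= w n <= 1.
Hypothesis wT : \sum_(n < N) w n <= T%:R.

(* For exponents r > 2 this is Young's inequality s^2 <= mu^2 (2/r (s/mu)^r + 1 - 2/r)
   at the scale mu = c T^(-1/r). *)
Lemma schatten_weighted_square_sum (p : \bar R) : (1 <= p)%E ->
  (schatten p s <= c%:E)%E ->
  \sum_(n < N) s n ^+ 2 * w n <= (c * T%:R `^ (rate_exponent p - 2^-1)) ^+ 2.
Proof.
move=> p1 hs; have sc n : s n <= c by exact: schatten_sv_le p1 hs.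
have T0' : 0 < T%:R :> R by rewrite ltr0n.
have sqrtT : (T%:R `^ (2^-1)) ^+ 2 = T%:R :> R.
  by rewrite -powR_mulrn ?powR_ge0 // -powRrM mulVf // powRr1 // ltW.
case: p p1 hs => [r| |] // p1 hs; last first.
  rewrite /rate_exponent (_ : 1 - 2^-1 = 2^-1 :> R); last lra.
  rewrite exprMn sqrtT; apply: le_trans (ler_wpM2l (sqr_ge0 c) wT).
  rewrite mulr_sumr; apply: ler_sum => n _; have /andP[w0 _] := w01 n.
  by apply: ler_wpM2r => //; rewrite ler_pXn2r ?nnegrE ?(ltW c0).
have r1 : 1 <= r by rewrite lee_fin in p1.
have r0 : 0 < r by exact: lt_le_trans r1.
(* For [r <= 2] the target is [c ^+ 2]: drop the weights and split the square into the powers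
   [2 - r] and [r], bounding the first factor by that of [c]. *)
have [r2|r2] := leP r 2.
  have -> : rate_exponent r%:E = 2^-1.
    rewrite /= max_l //; have : 2^-1 <= r^-1 by rewrite lef_pV2 ?posrE.
    by lra.
  rewrite subrr powRr0 mulr1.
  have hc : c `^ (2 - r) * c `^ r = c ^+ 2.
    by rewrite -powRD ?(gt_eqF c0) ?implybT // subrK powR_mulrn // ltW.
  rewrite -hc; apply: le_trans (ler_wpM2l (powR_ge0 _ _) (schatten_partial_sum N r0 hs)).
  rewrite mulr_sumr; apply: ler_sum => n _; have /andP[w0 w1] := w01 n.
  apply: (@le_trans _ _ (s n ^+ 2)); first by rewrite ler_piMr // sqr_ge0.
  have [->|sn0] := eqVneq (s n) 0.
    by rewrite expr0n /= mulr_ge0 ?powR_ge0.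
  have -> : s n ^+ 2 = s n `^ (2 - r) * s n `^ r.
    by rewrite -powRD ?sn0 ?implybT // subrK powR_mulrn.
  apply: ler_wpM2r; first exact: powR_ge0.
  by apply: ge0_ler_powR; rewrite ?nnegrE ?subr_ge0 // ltW.
have -> : rate_exponent r%:E = 1 - r^-1.
  rewrite /= max_r //; have : r^-1 <= 2^-1 by rewrite lef_pV2 ?posrE // ltW.
  by lra.
pose mu := c * T%:R `^ (- r^-1).
have mu0 : 0 < mu by rewrite mulr_gt0 ?powR_gt0.
have muT : mu ^+ 2 * T%:R = (c * T%:R `^ (1 - r^-1 - 2^-1)) ^+ 2.
  rewrite -[X in _ * X = _]sqrtT -exprMn -mulrA -powRD ?(gt_eqF T0') ?implybT //.
  by congr ((_ * _ `^ _) ^+ 2); lra.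
have mur : mu `^ r * T%:R = c `^ r.
  rewrite powRM ?powR_ge0 ?(ltW c0) // -powRrM mulNr mulVf ?gt_eqF //.
  by rewrite powR_inv1 ?ltW // mulfVK ?gt_eqF.
have young n : s n ^+ 2 <= mu ^+ 2 * (2 / r * (s n `^ r / mu `^ r) + (1 - 2 / r)).
  have q0 : 0 < r / (r - 2) by rewrite divr_gt0 ?subr_gt0.
  (* Young's inequality for the square of [s n / mu] and [1], with conjugate exponents [r / 2] and
     [r / (r - 2)]. *)
  have := @conjugate_powR _ ((s n / mu) ^+ 2) 1 (r / 2) (r / (r - 2)).
  rewrite sqr_ge0 ler01 divr_gt0 // q0 => /(_ isT isT isT isT).
  have -> : (r / 2)^-1 + (r / (r - 2))^-1 = 1 by field; rewrite !gt_eqF ?subr_gt0.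
  move=> /(_ erefl); rewrite powR1 mulr1.
  have -> : ((s n / mu) ^+ 2) `^ (r / 2) = s n `^ r / mu `^ r.
    rewrite -powR_mulrn ?divr_ge0 ?(ltW mu0) // -powRrM mulrCA divff // mulr1.
    rewrite powRM ?invr_ge0 ?(ltW mu0) //; congr (_ * _).
    by rewrite -powR_inv1 ?(ltW mu0) // powRAC powR_inv1 // powR_ge0.
  have -> : s n `^ r / mu `^ r / (r / 2) + 1 / (r / (r - 2))
     = 2 / r * (s n `^ r / mu `^ r) + (1 - 2 / r).
    by field; rewrite !gt_eqF ?subr_gt0 ?powR_gt0.
  rewrite exprMn exprVn ler_pdivrMr ?exprn_gt0 // mulrC; exact.
have r2' : 0 <= 1 - 2 / r by rewrite subr_ge0 ler_pdivrMr // mul1r ltW.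
(* By [mur] the power sum divided by that of [mu] is at most [T], and so is the sum of the weights;
   the coefficients [2 / r] and [1 - 2 / r] add up to one. *)
have bound : \sum_(n < N) (2 / r * (s n `^ r / mu `^ r) + (1 - 2 / r) * w n) <= T%:R.
  rewrite big_split /= -!mulr_sumr -mulr_suml.
  have h1 : (\sum_(n < N) s n `^ r) / mu `^ r <= T%:R.
    by rewrite ler_pdivrMr ?powR_gt0 // mulrC mur; exact: schatten_partial_sum.
  have h2 : 2 / r * ((\sum_(n < N) s n `^ r) / mu `^ r) <= 2 / r * T%:R.
    by apply: ler_wpM2l h1; rewrite divr_ge0 // ltW.
  by have := ler_wpM2l r2' wT; lra.
rewrite -muT; apply: le_trans (ler_wpM2l (sqr_ge0 mu) bound).
rewrite mulr_sumr; apply: ler_sum => n _; have /andP[w0 w1] := w01 n.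
apply: le_trans (ler_wpM2r w0 (young n)) _.
rewrite -(mulrA (mu ^+ 2)); apply: ler_wpM2l; first exact: sqr_ge0.
by rewrite mulrDl lerD2r ler_piMr //; apply: mulr_ge0; rewrite divr_ge0 ?powR_ge0 ?(ltW r0).
Qed.

End SchattenSequences.

(** * Bessel's inequality, Gram-Schmidt and Gram matrices *)

Section Orthogonality.
Context {R : realType} {V : normedModType R} {ip : V -> V -> R}.
Hypothesis ipP : inner_product_for ip.

Definition orthogonal_upto n (e : nat -> V) :=
  forall i j, (i < n)%N -> (j < n)%N -> i != j -> ip (e i) (e j) = 0.

Lemma sqr_norm_orthogonal_sum n (e : nat -> V) (a : nat -> R) : orthogonal_upto n e ->
  `|\sum_(i < n) a i *: e i| ^+ 2 = \sum_(i < n) a i ^+ 2 * `|e i| ^+ 2.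
Proof.
move=> oe; rewrite -(ip_norm ipP) (ip_suml ipP); apply: eq_bigr => i _.
rewrite (ip_sumr ipP) (bigD1 i) //= big1 ?addr0 => [|j ji].
  by rewrite (ipZl ipP) (ipZr ipP) (ip_norm ipP); ring.
by rewrite (ipZl ipP) (ipZr ipP) oe ?mulr0 // eq_sym.
Qed.

Lemma bessel n (e : nat -> V) (v : V) : orthogonal_upto n e ->
  (forall i, (i < n)%N -> `|e i| <= 1) ->
  \sum_(i < n) ip v (e i) ^+ 2 <= `|v| ^+ 2.
Proof.
move=> oe e1.
have : 0 <= `|v - \sum_(i < n) ip v (e i) *: e i| ^+ 2 by exact: sqr_ge0.
rewrite (sqr_normB ipP) (sqr_norm_orthogonal_sum (fun i => ip v (e i)) oe) (ip_sumr ipP).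
under eq_bigr do rewrite (ipZr ipP) -expr2.
have : \sum_(i < n) ip v (e i) ^+ 2 * `|e i| ^+ 2 <= \sum_(i < n) ip v (e i) ^+ 2.
  by apply: ler_sum => i _; rewrite ler_piMr ?sqr_ge0 // exprn_ile1 ?e1.
lra.
Qed.

Lemma gram_schmidt n (x : nat -> V) : exists e : nat -> V,
  [/\ orthogonal_upto n e,
      forall i, (i < n)%N -> e i = 0 \/ `|e i| = 1 &
      forall t, (t < n)%N -> x t = \sum_(k < n) ip (x t) (e k) *: e k].
Proof.
elim: n => [|n [e [oe e1 xe]]]; first by exists (fun=> 0); split.
pose y := \sum_(k < n) ip (x n) (e k) *: e k.
pose r := x n - y.
(* When [x n] already lies in the span, [r] is zero and so is [u]; the family is extended in the
   same way in both cases. *)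
pose u := `|r|^-1 *: r.
have re j : (j < n)%N -> ip r (e j) = 0.
  move=> jn; rewrite (ipBl ipP) (ip_suml ipP) (bigD1 (Ordinal jn)) //= big1 => [|i ij].
    rewrite addr0 (ipZl ipP) (ip_norm ipP).
    by case: (e1 j jn) => ->; [rewrite (ip0r ipP) mul0r subrr
                              |rewrite expr1n mulr1 subrr].
  by rewrite (ipZl ipP) oe ?mulr0.
have ue j : (j < n)%N -> ip u (e j) = 0.
  by move=> jn; rewrite (ipZl ipP) re ?mulr0.
have uspan (a : nat -> R) : ip (\sum_(k < n) a k *: e k) u = 0.
  rewrite (ip_suml ipP) big1 // => k _.
  by rewrite (ipZl ipP) (ipC ipP) ue ?mulr0.
have xu : ip (x n) u *: u = r.
  have -> : ip (x n) u = `|r|.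
    rewrite -[x n](subrK y) -/r (ipDl ipP) (uspan (fun k => ip (x n) (e k))) addr0 (ipZr ipP) (ip_norm ipP).
    have [->|r0] := eqVneq r 0; first by rewrite normr0 expr0n mulr0.
    by rewrite expr2 mulKf ?normr_eq0.
  have [->|r0] := eqVneq r 0; first by rewrite normr0 scale0r.
  by rewrite scalerA divff ?normr_eq0 // scale1r.
exists (fun k => if k == n then u else e k); split.
- move=> i j; rewrite !ltnS => ilen jlen ij.
  case: (eqVneq i n) ilen => [i_n _|in_ ilen]; last first.
    have {}ilen : (i < n)%N by rewrite ltn_neqAle in_.
    case: (eqVneq j n) jlen => [_ _|jn jlen]; first by rewrite (ipC ipP) ue.
    by apply: oe => //; rewrite ltn_neqAle jn.
  have jn : j != n by rewrite -i_n eq_sym.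
  by rewrite (negPf jn) ue // ltn_neqAle jn.
- move=> i; rewrite ltnS => ilen.
  case: (eqVneq i n) ilen => [_ _|in_ ilen]; last by apply: e1; rewrite ltn_neqAle in_.
  have [r0|r0] := eqVneq r 0; first by left; rewrite /u r0 scaler0.
  by right; rewrite /u normrZ normfV normr_id mulVf ?normr_eq0.
- move=> t; rewrite ltnS => tn; rewrite big_ord_recr /= eqxx.
  under eq_bigr => k _ do rewrite (ltn_eqF (ltn_ord k)).
  case: (eqVneq t n) tn => [-> _|tn' tn]; first by rewrite xu addrC subrK.
  have {}tn : (t < n)%N by rewrite ltn_neqAle tn'.
  have -> : ip (x t) u = 0 by rewrite (xe t tn) (uspan (fun k => ip (x t) (e k))).
  by rewrite scale0r addr0; exact: xe.
Qed.

Lemma orthogonal_expansion T (x : 'I_T -> V) : exists e : nat -> V,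
  [/\ orthogonal_upto T e, forall i, (i < T)%N -> `|e i| <= 1 &
      forall t, x t = \sum_(k < T) ip (x t) (e k) *: e k].
Proof.
have [e [oe e1 xe]] := gram_schmidt T (fun n => oapp x 0 (insub n)).
exists e; split=> // [i /e1[->|->]|t]; rewrite ?normr0 //.
by have := xe t (ltn_ord t); rewrite valK.
Qed.

End Orthogonality.

(** Expand the squares and sum over [k] first, using the expansion of [x t']. The right side no
    longer mentions the basis, which varies with the sign path, so it can be averaged over paths. *)
Lemma gram_sum (R : realType) (V W : normedModType R) (ipV : V -> V -> R)
    (ipW : W -> W -> R) (T : nat) (x : 'I_T -> V) (e : nat -> V) (w : 'I_T -> W) :
  inner_product_for ipV -> inner_product_for ipW ->
  (forall t, x t = \sum_(k < T) ipV (x t) (e k) *: e k) ->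
  \sum_(k < T) `|\sum_(t < T) ipV (x t) (e k) *: w t| ^+ 2
  = \sum_(t < T) \sum_(t' < T) ipV (x t) (x t') * ipW (w t) (w t').
Proof.
move=> VP WP xe.
have -> : \sum_(k < T) `|\sum_(t < T) ipV (x t) (e k) *: w t| ^+ 2
    = \sum_(k < T) \sum_(t < T) \sum_(t' < T)
       ipV (x t) (e k) * ipV (x t') (e k) * ipW (w t) (w t').
  apply: eq_bigr => k _; rewrite -(ip_norm WP) (ip_suml WP); apply: eq_bigr => t _.
  rewrite (ip_sumr WP); apply: eq_bigr => t' _.
  by rewrite (ipZl WP) (ipZr WP) mulrA.
rewrite exchange_big /=; apply: eq_bigr => t _.
rewrite exchange_big /=; apply: eq_bigr => t' _.
rewrite -mulr_suml; congr (_ * _); rewrite [in RHS](xe t') (ip_sumr VP).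
by apply: eq_bigr => k _; rewrite (ipZr VP) mulrC.
Qed.

(** * Estimates for truncated Schmidt sums *)

Section Truncation.
Context {R : realType} {V W : normedModType R}.
Context {ipV : V -> V -> R} {ipW : W -> W -> R}.
Hypothesis VP : inner_product_for ipV.
Hypothesis WP : inner_product_for ipW.
Variables (s : nat -> R) (e : nat -> V) (u : nat -> W).
Hypothesis s0 : forall n, 0 <= s n.
Hypothesis oe : Defs.orthonormal ipV e.
Hypothesis ou : Defs.orthonormal ipW u.

Definition schmidt_sum N (v : V) : W := \sum_(n < N) (s n * ipV v (e n)) *: u n.

Lemma orthonormal_norm (E : normedModType R) (ip : E -> E -> R) (f : nat -> E) n :
  inner_product_for ip -> Defs.orthonormal ip f -> `|f n| = 1.
Proof.
move=> P of_; apply/eqP; rewrite -(@eqrXn2 _ 2) // -(ip_norm P) of_ eqxx expr1n //.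
Qed.

Lemma schmidt_sum_lincomb N T (a : 'I_T -> R) (x : 'I_T -> V) :
  schmidt_sum N (\sum_(t < T) a t *: x t) = \sum_(t < T) a t *: schmidt_sum N (x t).
Proof.
under [RHS]eq_bigr do rewrite scaler_sumr.
rewrite exchange_big /=; apply: eq_bigr => n _.
rewrite (ip_suml VP) mulr_sumr scaler_suml; apply: eq_bigr => t _.
by rewrite (ipZl VP) scalerA mulrCA.
Qed.

Lemma sqr_norm_schmidt_sum N v :
  `|schmidt_sum N v| ^+ 2 = \sum_(n < N) s n ^+ 2 * ipV v (e n) ^+ 2.
Proof.
rewrite (sqr_norm_orthogonal_sum WP (fun n => s n * ipV v (e n))).
  by apply: eq_bigr => n _; rewrite (orthonormal_norm n WP ou) expr1n mulr1 exprMn.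
by move=> i j _ _ ij; rewrite ou (negPf ij).
Qed.

Lemma orthonormal_bessel N v : \sum_(n < N) ipV v (e n) ^+ 2 <= `|v| ^+ 2.
Proof.
apply: (bessel VP) => [i j _ _ ij|i _]; first by rewrite oe (negPf ij).
by rewrite (orthonormal_norm i VP oe).
Qed.

Variables (c : R) (p : \bar R).
Hypothesis c0 : 0 < c.
Hypothesis p1 : (1 <= p)%E.
Hypothesis sp : (schatten p s <= c%:E)%E.

Lemma sqr_norm_schmidt_sum_le N v : `|schmidt_sum N v| ^+ 2 <= c ^+ 2 * `|v| ^+ 2.
Proof.
rewrite sqr_norm_schmidt_sum.
apply: le_trans (ler_wpM2l (sqr_ge0 c) (orthonormal_bessel N v)).
rewrite mulr_sumr; apply: ler_sum => n _; apply: ler_wpM2r; first exact: sqr_ge0.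
by rewrite ler_pXn2r ?nnegrE ?(ltW c0) //; exact: (schatten_sv_le s0 c0 n p1 sp).
Qed.

Variables (T : nat).
Hypothesis T0 : (0 < T)%N.

(* Sum over k of the n-th Fourier weights of eps_k: at most 1 for each n by Bessel
   for eps, at most T in total by Bessel for e. *)
Lemma schmidt_sum_hilbert_schmidt N (eps : nat -> V) : @orthogonal_upto _ _ ipV T eps ->
  (forall i, (i < T)%N -> `|eps i| <= 1) ->
  \sum_(k < T) `|schmidt_sum N (eps k)| ^+ 2
  <= (c * T%:R `^ (rate_exponent p - 2^-1)) ^+ 2.
Proof.
move=> oeps eps1.
pose w n := \sum_(k < T) ipV (eps k) (e n) ^+ 2.
under eq_bigr do rewrite sqr_norm_schmidt_sum.
rewrite exchange_big /=; under eq_bigr do rewrite -mulr_sumr -/(w _).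
apply: (schatten_weighted_square_sum s0 c0 T0 _ _ p1 sp) => [n|].
  apply/andP; split; first by apply: sumr_ge0 => k _; exact: sqr_ge0.
  rewrite /w; under eq_bigr do rewrite (ipC VP).
  by apply: le_trans (bessel VP (e n) oeps eps1) _; rewrite (orthonormal_norm n VP oe) expr1n.
rewrite exchange_big /=.
have -> : T%:R = \sum_(k < T) (1 : R) by rewrite sumr_const card_ord.
apply: ler_sum => k _; apply: le_trans (orthonormal_bessel N _) _.
by rewrite exprn_ile1 ?eps1.
Qed.

(** Expanding each [x t] in the basis regroups the sum by basis vector. [ip_young] for each [k] then
    separates the Hilbert-Schmidt norm of the operator from a Gram sum of the data. *)
Lemma schmidt_sum_young N (a : R) (x : 'I_T -> V) (w : 'I_T -> W) : 0 < a ->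
  2 * \sum_(t < T) ipW (schmidt_sum N (x t)) (w t)
  <= a * (c * T%:R `^ (rate_exponent p - 2^-1)) ^+ 2
     + a^-1 * \sum_(t < T) \sum_(t' < T) ipV (x t) (x t') * ipW (w t) (w t').
Proof.
move=> a0; have [eps [oeps eps1 xe]] := orthogonal_expansion VP x.
have -> : \sum_(t < T) ipW (schmidt_sum N (x t)) (w t)
    = \sum_(k < T) ipW (schmidt_sum N (eps k)) (\sum_(t < T) ipV (x t) (eps k) *: w t).
  under [RHS]eq_bigr do rewrite (ip_sumr WP).
  rewrite exchange_big /=; apply: eq_bigr => t _.
  rewrite [in LHS](xe t) schmidt_sum_lincomb (ip_suml WP); apply: eq_bigr => k _.
  by rewrite (ipZl WP) (ipZr WP).
rewrite -(gram_sum w VP WP xe).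
have h := ler_wpM2l (ltW a0) (schmidt_sum_hilbert_schmidt N oeps eps1).
apply: (@le_trans _ _ (a * (\sum_(k < T) `|schmidt_sum N (eps k)| ^+ 2)
   + a^-1 * \sum_(k < T) `|\sum_(t < T) ipV (x t) (eps k) *: w t| ^+ 2)); last by rewrite lerD2r.
rewrite !mulr_sumr -big_split /=; apply: ler_sum => k _; exact: ip_young.
Qed.

(** By [gram_sum] both sides are sums of squared norms over basis vectors, and the operator norm is
    at most [c]. This removes the operator from the Gram sum, as is necessary before taking the
    supremum over the class. *)
Lemma schmidt_sum_gram_le N (x z : 'I_T -> V) :
  \sum_(t < T) \sum_(t' < T) ipV (x t) (x t')
      * ipW (schmidt_sum N (z t)) (schmidt_sum N (z t'))
  <= c ^+ 2 * \sum_(t < T) \sum_(t' < T) ipV (x t) (x t') * ipV (z t) (z t').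
Proof.
have [eps [_ _ xe]] := orthogonal_expansion VP x.
rewrite -(gram_sum _ VP WP xe) -(gram_sum z VP VP xe) mulr_sumr.
apply: ler_sum => k _; rewrite -schmidt_sum_lincomb; exact: sqr_norm_schmidt_sum_le.
Qed.

End Truncation.

(** * Limits of finite sums and averages over sign paths *)

Lemma cvg_big_sum (R : realType) (I : Type) (r : seq I) (a : I -> nat -> R) (b : I -> R) :
  (forall i, a i n @[n --> \oo] --> b i) ->
  \sum_(i <- r) a i n @[n --> \oo] --> \sum_(i <- r) b i.
Proof.
move=> ab; elim: r => [|i r IH].
  by under eq_fun do rewrite big_nil; rewrite big_nil; exact: cvg_cst.
by under eq_fun do rewrite big_cons; rewrite big_cons; exact: cvgD.
Qed.

Section SequentialAverages.
Context {R : realType} {T : nat}.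
Implicit Types (s : {ffun 'I_T -> bool}).

Lemma sqr_sgn (b : bool) : sgn b * sgn b = 1 :> R.
Proof. by case: b; rewrite /sgn; ring. Qed.

(* Off-diagonal terms vanish: flipping the later of the two coordinates changes their sign. *)
Lemma sum_quadratic_form (q : 'I_T -> 'I_T -> {ffun 'I_T -> bool} -> R) :
  (forall (i t t' : 'I_T) s, (t <= i)%N -> (t' <= i)%N -> q t t' (flip i s) = q t t' s) ->
  \sum_(s : {ffun 'I_T -> bool}) \sum_(t < T) \sum_(t' < T)
     (sgn (s t) * sgn (s t')) * q t t' s
  = \sum_(s : {ffun 'I_T -> bool}) \sum_(t < T) q t t s.
Proof.
move=> qflip.
rewrite exchange_big [RHS]exchange_big /=; apply: eq_bigr => t _.
rewrite exchange_big /= (bigD1 t) //= [X in _ + X]big1 ?addr0 => [|t' tt'].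
  by apply: eq_bigr => s _; rewrite sqr_sgn mul1r.
have [lt|gt|eqt] := ltngtP t t'; last by rewrite (val_inj eqt) eqxx in tt'.
- rewrite -[RHS](@sum_sgn_flip R T t' (fun s => sgn (s t) * q t t' s)) => [|s].
    by apply: eq_bigr => s _; rewrite -mulrA mulrCA.
  by rewrite flip_lt // qflip // ltnW.
- rewrite -[RHS](@sum_sgn_flip R T t (fun s => sgn (s t') * q t t' s)) => [|s].
    by apply: eq_bigr => s _; rewrite -mulrA.
  by rewrite flip_lt // qflip // ltnW.
Qed.

End SequentialAverages.

(** * The Rademacher bound for Schatten balls *)

Section SchattenRademacher.
Context {R : realType} {V W : normedModType R}.
Context {ipV : V -> V -> R} {ipW : W -> W -> R}.
Hypothesis VP : inner_product_for ipV.
Hypothesis WP : inner_product_for ipW.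
Variables (c : R) (p : \bar R) (T : nat).
Hypothesis c0 : 0 < c.
Hypothesis p1 : (1 <= p)%E.
Let X := [set v : V | `|v| <= 1].
Let Y := [set w : W | `|w| <= c].
Let F := schatten_ball ipV ipW p c.

Lemma schatten_ball_bounded (f : V -> W) v : F f -> X v -> `|f v| <= c.
Proof.
move=> [s [[s0 [_ [_ [e [u [oe [ou sf]]]]]]] sp]] Xv.
apply: (@cvgr_to_le _ \oo _ _ (fun N => `|schmidt_sum (ipV := ipV) s e u N v|)).
  by apply: cvg_norm; exact: sf.
apply: nearW => N; rewrite -(@ler_pXn2r _ 2) ?nnegrE ?(ltW c0) //.
apply: le_trans (sqr_norm_schmidt_sum_le VP WP s0 oe ou c0 p1 sp N v) _.
by rewrite ler_piMr ?sqr_ge0 // exprn_ile1.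
Qed.

Hypothesis T0 : (0 < T)%N.
(** [K] bounds the Hilbert-Schmidt norm on the span of the inputs. The scale [a] balances Young's
    inequality: [a * K ^+ 2] and [a^-1 * (c ^+ 2 * T%:R)] both equal [c ^+ 2] times the target power
    of [T]. *)
Let K := c * T%:R `^ (rate_exponent p - 2^-1).
Let sqT : R := T%:R `^ (2^-1).
Let a := c * sqT / K.

Lemma sqT_sqr : sqT ^+ 2 = T%:R.
Proof. by rewrite -powR_mulrn ?powR_ge0 // -powRrM mulVf // powRr1. Qed.

Lemma sqT_gt0 : 0 < sqT.
Proof. by rewrite powR_gt0 // ltr0n. Qed.

Lemma K_gt0 : 0 < K.
Proof. by rewrite mulr_gt0 // powR_gt0 // ltr0n. Qed.

Lemma KsqT : K * (c * sqT) = c ^+ 2 * T%:R `^ rate_exponent p.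
Proof.
rewrite /K /sqT mulrACA -expr2 -powRD ?subrK //.
by apply/implyP => _; rewrite pnatr_eq0 -lt0n.
Qed.

(** The coefficient of the product of the signs at [t] and [t']: the first term comes from the
    squared norms of the [f x], the second from their inner products with the [y]. *)
Definition signed_gram (x : 'I_T -> V) (y : 'I_T -> W) (t t' : 'I_T) :=
  c ^+ 2 / 2 * ipV (x t) (x t') ^+ 2 + ipV (x t) (x t') * ipW (y t) (y t').

(** The right side does not depend on [f], so it bounds the supremum over the class on each sign
    path before any averaging. *)
Lemma schatten_path_bound (f : V -> W) (x : 'I_T -> V) (y : 'I_T -> W)
    (s : {ffun 'I_T -> bool}) : F f ->
  \sum_(t < T) sgn (s t) * sqloss f (x t) (y t)
  <= \sum_(t < T) sgn (s t) * `|y t| ^+ 2 + 3 / 2 * (a * K ^+ 2)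
     + a^-1 * \sum_(t < T) \sum_(t' < T) (sgn (s t) * sgn (s t')) * signed_gram x y t t'.
Proof.
move=> [sv [[s0 [_ [_ [e [u [oe [ou sf]]]]]]] sp]].
pose g := schmidt_sum (ipV := ipV) sv e u.
have a0 : 0 < a by rewrite divr_gt0 ?K_gt0 // mulr_gt0 ?sqT_gt0.
(* The loss is continuous along the Schmidt expansion, so it suffices to bound every truncation. *)
apply: (@cvgr_to_le _ \oo _ _ (fun N => \sum_(t < T) sgn (s t) * sqloss (g N) (x t) (y t))).
  apply: cvg_big_sum => t; apply: cvgM; first exact: cvg_cst.
  rewrite /sqloss; under eq_fun do rewrite expr2; rewrite expr2.
  have h : `|g N (x t) - y t| @[N --> \oo] --> `|f (x t) - y t|.
    by apply: cvg_norm; apply: cvgB; [exact: sf|exact: cvg_cst].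
  exact: cvgM.
apply: nearW => N.
(* The final sum takes half of [y1], for the quadratic part, and all of [y2], whose cross term
   already carries the factor 2; hence the coefficient [3 / 2]. *)
have y1 := schmidt_sum_young VP WP s0 oe ou c0 p1 sp T0 N x
   (fun t => schmidt_sum (ipV := ipV) sv e u N (sgn (s t) *: x t)) a0.
have y2 := schmidt_sum_young VP WP s0 oe ou c0 p1 sp T0 N x
   (fun t => (- sgn (s t)) *: y t) a0.
have gr := schmidt_sum_gram_le VP WP s0 oe ou c0 p1 sp N x (fun t => sgn (s t) *: x t).
have gZ (b : R) v : g N (b *: v) = b *: g N v.
  have := schmidt_sum_lincomb VP sv e u N (fun _ : 'I_1 => b) (fun=> v).
  by rewrite !big_ord1.
rewrite -/K -/(g N) in y1 y2 gr.
have t1 : \sum_(t < T) ipW (g N (x t)) (g N (sgn (s t) *: x t))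
    = \sum_(t < T) sgn (s t) * `|g N (x t)| ^+ 2.
  by apply: eq_bigr => t _; rewrite gZ (ipZr WP) (ip_norm WP).
have t2 : 2 * \sum_(t < T) ipW (g N (x t)) (- sgn (s t) *: y t)
    = \sum_(t < T) sgn (s t) * (- (2 * ipW (g N (x t)) (y t))).
  by rewrite mulr_sumr; apply: eq_bigr => t _; rewrite (ipZr WP); ring.
have split : \sum_(t < T) sgn (s t) * sqloss (g N) (x t) (y t)
    = \sum_(t < T) sgn (s t) * `|g N (x t)| ^+ 2
      + \sum_(t < T) sgn (s t) * (- (2 * ipW (g N (x t)) (y t)))
      + \sum_(t < T) sgn (s t) * `|y t| ^+ 2.
  rewrite -!big_split /=; apply: eq_bigr => t _.
  by rewrite /sqloss (sqr_normB WP) -!mulrDr.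
have q1 : \sum_(t < T) \sum_(t' < T) ipV (x t) (x t')
      * ipV (sgn (s t) *: x t) (sgn (s t') *: x t')
    = \sum_(t < T) \sum_(t' < T) (sgn (s t) * sgn (s t')) * ipV (x t) (x t') ^+ 2.
  by apply: eq_bigr => t _; apply: eq_bigr => t' _; rewrite (ipZl VP) (ipZr VP); ring.
have q2 : \sum_(t < T) \sum_(t' < T) ipV (x t) (x t')
      * ipW (- sgn (s t) *: y t) (- sgn (s t') *: y t')
    = \sum_(t < T) \sum_(t' < T) (sgn (s t) * sgn (s t'))
         * (ipV (x t) (x t') * ipW (y t) (y t')).
  by apply: eq_bigr => t _; apply: eq_bigr => t' _; rewrite (ipZl WP) (ipZr WP); ring.
have q3 : \sum_(t < T) \sum_(t' < T) (sgn (s t) * sgn (s t')) * signed_gram x y t t'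
    = c ^+ 2 / 2 * \sum_(t < T) \sum_(t' < T) (sgn (s t) * sgn (s t')) * ipV (x t) (x t') ^+ 2
      + \sum_(t < T) \sum_(t' < T) (sgn (s t) * sgn (s t'))
         * (ipV (x t) (x t') * ipW (y t) (y t')).
  rewrite mulr_sumr -big_split /=; apply: eq_bigr => t _.
  rewrite mulr_sumr -big_split /=; apply: eq_bigr => t' _.
  by rewrite /signed_gram; ring.
rewrite q1 in gr; rewrite q2 t2 in y2; rewrite t1 in y1; rewrite split q3.
have ai : 0 <= a^-1 by rewrite invr_ge0 ltW.
have := ler_wpM2l ai gr.
move: y1 y2; lra.
Qed.

(** On averaging the path bound, the [y] term vanishes by predictability and the Gram term reduces
    to its diagonal, at most [3 / 2 * (c ^+ 2 * T%:R)]. By the choice of [a], this and the constant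
    term each contribute at most half of the bound. *)
Lemma schatten_rademacher_le_pos :
  (seq_rademacher X Y T F <= (3 * c ^+ 2 * T%:R `^ rate_exponent p)%:E)%E.
Proof.
apply: ge_ereal_sup => _ [x [y [xP [yP [xX [yY ->]]]]]].
pose gram t t' s := signed_gram (x^~ s) (y^~ s) t t'.
pose U (s : {ffun 'I_T -> bool}) := \sum_(t < T) sgn (s t) * `|y t s| ^+ 2 + 3 / 2 * (a * K ^+ 2)
     + a^-1 * \sum_(t < T) \sum_(t' < T) (sgn (s t) * sgn (s t')) * gram t t' s.
have a0 : 0 < a by rewrite divr_gt0 ?K_gt0 // mulr_gt0 ?sqT_gt0.
have T2 : 0 < 2 ^+ T :> R by rewrite exprn_gt0.
have cardS (r : R) : \sum_(s : {ffun 'I_T -> bool}) r = 2 ^+ T * r.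
  by rewrite sumr_const cardT -cardE card_ffun card_bool card_ord -natrX mulr_natl.
have s1 : \sum_(s : {ffun 'I_T -> bool}) \sum_(t < T) sgn (s t) * `|y t s| ^+ 2 = 0.
  rewrite exchange_big /= big1 // => t _; apply: sum_sgn_flip => s.
  by rewrite (predictable_flip s yP (leqnn t)).
have s2 : \sum_(s : {ffun 'I_T -> bool}) \sum_(t < T) \sum_(t' < T) (sgn (s t) * sgn (s t')) * gram t t' s
    <= 2 ^+ T * (3 / 2 * (c ^+ 2 * T%:R)).
  rewrite sum_quadratic_form; last first.
    move=> i t t' s ti ti'; rewrite /gram /signed_gram.
    by rewrite !(predictable_flip s xP) // !(predictable_flip s yP).
  rewrite -cardS; apply: ler_sum => s _.
  have -> : 3 / 2 * (c ^+ 2 * T%:R) = \sum_(t < T) (3 / 2 * c ^+ 2).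
    by rewrite sumr_const card_ord -[RHS]mulr_natr; ring.
  apply: ler_sum => t _; rewrite /gram /signed_gram (ip_norm VP) (ip_norm WP).
  have x1 : `|x t s| ^+ 2 <= 1 by rewrite exprn_ile1 //; exact: xX.
  have y1 : `|y t s| ^+ 2 <= c ^+ 2 by rewrite ler_pXn2r ?nnegrE ?(ltW c0) //; exact: yY.
  have xx : `|x t s| ^+ 2 ^+ 2 <= 1 by rewrite exprn_ile1 ?sqr_ge0.
  have h1 : c ^+ 2 / 2 * `|x t s| ^+ 2 ^+ 2 <= c ^+ 2 / 2.
    by rewrite ler_piMr // divr_ge0 ?sqr_ge0.
  have h2 : `|x t s| ^+ 2 * `|y t s| ^+ 2 <= c ^+ 2.
    by apply: le_trans y1; rewrite ler_piMl ?sqr_ge0.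
  lra.
have sumU : \sum_s U s <= 2 ^+ T * (3 * c ^+ 2 * T%:R `^ rate_exponent p).
  rewrite /U !big_split /= s1 add0r cardS -mulr_sumr.
  have aK : a * K ^+ 2 = c ^+ 2 * T%:R `^ rate_exponent p.
    by rewrite -KsqT /a; field; rewrite gt_eqF ?K_gt0.
  have aT : a^-1 * (c ^+ 2 * T%:R) = c ^+ 2 * T%:R `^ rate_exponent p.
    rewrite -KsqT /a -sqT_sqr; field.
    by rewrite !gt_eqF ?K_gt0 ?sqT_gt0.
  have ai : 0 <= a^-1 by rewrite invr_ge0 ltW.
  have := ler_wpM2l ai s2; rewrite aK.
  have -> : a^-1 * (2 ^+ T * (3 / 2 * (c ^+ 2 * T%:R)))
     = 2 ^+ T * (3 / 2 * (a^-1 * (c ^+ 2 * T%:R))) by ring.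
  rewrite aT; lra.
apply: (@le_trans _ _ ((((2 ^+ T)^-1 : R)%:E * \sum_s (U s)%:E)%E)).
  apply: lee_wpmul2l; first by rewrite lee_fin invr_ge0 ltW.
  apply: lee_sum => s _; apply: ge_ereal_sup => _ [f Ff <-]; rewrite lee_fin.
  exact: schatten_path_bound.
by rewrite sumEFin -EFinM lee_fin ler_pdivrMl.
Qed.

End SchattenRademacher.

(** * Degenerate cases and assembly of the two inequalities *)

Lemma seq_rademacher0_le0 (R : realType) (V W : normedModType R) (X : set V) (Y : set W)
  (F : set (V -> W)) : (seq_rademacher X Y 0 F <= 0)%E.
Proof.
apply: ge_ereal_sup => _ [x [y [_ [_ [_ [_ ->]]]]]].
apply: mule_ge0_le0; first by rewrite lee_fin invr_ge0 exprn_ge0.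
apply: sume_le0 => s _; apply: ge_ereal_sup => _ [f _ <-].
by rewrite big_ord0.
Qed.

(** Over an empty class the comparator infimum is +oo, so the constant prediction [0] has regret
    -oo. The theorem can then split on emptiness of the ball instead of constructing the orthonormal
    sequences that an element requires. *)
Lemma minimax_regret_set0 (R : realType) (V W : normedModType R) (X : set V) (c : R) T :
  0 <= c -> minimax_regret X [set w : W | `|w| <= c] T set0 = -oo%E.
Proof.
move=> c0; apply/eqP; rewrite -leeNy_eq.
apply: ge_ereal_inf; eexists.
  exists _, unit, \d_tt, (fun _ _ _ => 0); split=> //.
  by split=> [w h v|h v y]; [rewrite /= normr0|exact: measurable_cst].
apply: ge_ereal_sup => _ [xy [_ ->]].
rewrite image_set0 ereal_inf0 (_ : integral _ _ _ = -oo * \d_tt setT)%E.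
  by rewrite probability_setT mule1.
exact: integral_cst.
Qed.
Unset Implicit Arguments.

Theorem theorem1 (R : realType) (V W : completeNormedModType R)
    (ipV : V -> V -> R) (ipW : W -> W -> R)
    (HV : separable_inf_dim_hilbert ipV) (HW : separable_inf_dim_hilbert ipW)
    (c : R) (p : \bar R) (hc : 0 < c) (hp : (1 <= p)%E) (T : nat) :
  let X := [set v : V | `|v| <= 1] in
  let Y := [set w : W | `|w| <= c] in
  let F := schatten_ball ipV ipW p c in
  (minimax_regret X Y T F <= 2%:E * seq_rademacher X Y T F)%E /\
  (2%:E * seq_rademacher X Y T F
     <= (6 * c ^+ 2 * (T%:R `^ rate_exponent p))%:E)%E.
Proof.
move=> X Y F; have [VP _] := HV; have [WP _] := HW; split.
  have [->|/set0P F0] := eqVneq F set0; first by rewrite minimax_regret_set0 ?leNye ?ltW.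
  have X0 : X !=set0 by exists 0; rewrite /X /= normr0.
  have FX f x : F f -> X x -> `|f x| <= c by exact: schatten_ball_bounded.
  apply: le_trans (minimax_regret_le_relaxation WP hc X0 F0 FX T) _.
  exact: (relaxation_le_rademacher T F0 (game_moves_neq0 hc X0) (loss_bounded hc FX)).
apply: (@le_trans _ _ (2%:E * (3 * c ^+ 2 * (T%:R `^ rate_exponent p))%:E)%E); last first.
  by rewrite -EFinM lee_fin !mulrA -natrM.
apply: lee_wpmul2l; first by rewrite lee_fin.
(* The estimates divide by powers of [T]; for [T = 0] the complexity is at most zero and the bound
   is nonnegative. *)
have [T0|T0] := posnP T; last exact: schatten_rademacher_le_pos.
rewrite T0; apply: le_trans (seq_rademacher0_le0 _ _ _) _.
by rewrite lee_fin mulr_ge0 ?powR_ge0 // mulr_ge0 // sqr_ge0.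
Qed.
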